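(* Let $X$ be a real Banach space with a normalized Schauder basis $\mathcal B=(e_n)_{n=1}^\infty$ with biorthogonal functionals $(e_n^* )$, and let $\mathcal E=(\varepsilon_n)_{n=1}^\infty$ be a sequence of nonnegative numbers. The following are equivalent: (1) the brick $K_{\mathcal B,\mathcal E}$ is compact; (2) $K_{\mathcal B,\mathcal E}$ is holistic, i.e. for every scalar sequence $(a_n)$ with $|a_n|\le\varepsilon_n$ for all $n$ the series $\sum_{n=1}^\infty a_ne_n$ converges; (3) the series $\sum_{n=1}^\infty\varepsilon_ne_n$ converges unconditionally; (4) $r^{\rm unc}(K_{\mathcal B,\mathcal E})<\infty$.
   Context: The brick is $K_{\mathcal B,\mathcal E}=\{x\in X:\ |e_n^*(x)|\le\varepsilon_n \text{ for all } n\}$. The unconditional radius is $r^{\rm unc}(K_{\mathcal B,\mathcal E})=\sup_{\theta_n=\pm1}\|\sum_{n=1}^\infty\theta_n\varepsilon_ne_n\|$, where the norm of a divergent series is $\infty$. A series converges unconditionally if every rearrangement of it converges. *)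

(* Defs.v *)
From HB Require Import structures.
From mathcomp Require Import all_boot all_order all_algebra.
From mathcomp Require Import all_classical all_reals all_analysis.
Set Implicit Arguments. Unset Strict Implicit. Unset Printing Implicit Defensive.
Import Order.TTheory GRing.Theory Num.Theory.
Import numFieldNormedType.Exports.
Local Open Scope classical_set_scope.
Local Open Scope ring_scope.

Section Defs.
Context {R : realType} {X : normedModType R}.

Definition schauder_basis (e : nat -> X) : Prop :=
  forall x : X, exists! a : nat -> R, series (fun n => a n *: e n) @ \oo --> x.

Definition normalized (e : nat -> X) : Prop := forall n, `|e n| = 1.

Definition coordinate_functionals (e : nat -> X) (es : nat -> X -> R) : Prop :=
  forall x : X, series (fun n => es n x *: e n) @ \oo --> x.

Definition brick (es : nat -> X -> R) (eps : nat -> R) : set X :=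
  [set x | forall n, `|es n x| <= eps n].

Definition holistic (e : nat -> X) (eps : nat -> R) : Prop :=
  forall a : nat -> R, (forall n, `|a n| <= eps n) ->
    cvgn (series (fun n => a n *: e n)).

Definition unconditionally_convergent (u : nat -> X) : Prop :=
  forall s : nat -> nat, bijective s -> cvgn (series (u \o s)).

Definition series_norm (u : nat -> X) : \bar R :=
  if `[< cvgn (series u) >] then (`|lim (series u @ \oo)|)%:E else +oo%E.

Definition r_unc (e : nat -> X) (eps : nat -> R) : \bar R :=
  ereal_sup [set series_norm (fun n => theta n * eps n *: e n) |
             theta in [set th : nat -> R | forall n, th n = 1 \/ th n = -1]].
End Defs.

(* Main.v *)
Require Import Defs.
From HB Require Import structures.
From mathcomp Require Import all_boot all_order all_algebra.
From mathcomp Require Import all_classical all_reals all_analysis.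
From mathcomp Require Import ring lra zify.
Import Order.TTheory GRing.Theory Num.Theory.
Import numFieldNormedType.Exports.
Local Open Scope classical_set_scope.
Local Open Scope ring_scope.

(** Write [u n = eps n *: e n]. All four conditions are equivalent to the
    following Cauchy condition: sums of [u] over finite sets of large indices
    are uniformly small. If it fails, there are consecutive blocks of indices,
    each containing a subset over which the sum of [u] has norm at least
    [d > 0]. Taking these subsets together gives a divergent subseries, and
    listing each of them first within its block gives a divergent
    rearrangement. If the brick is compact, the block sums cluster at some [w]
    with [w != 0]; sums of [m] blocks close to [w] stay in the brick but have
    norm of order [m], which contradicts boundedness (so continuity of the
    coordinate functionals is never needed). Conversely, the Cauchy condition
    extends by convexity from subset sums to coefficients in [[-1, 1]], so
    [t |-> \sum_i t i *: u i] is a uniform limit of continuous maps on the cube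
    [[-1, 1]^nat], which is compact by Tychonoff, and the brick is its image. *)

(** * Consecutive blocks [[N k, N k.+1)] partitioning the indices *)

Section Blocks.
Context {N : nat -> nat} (N_lt : forall k, (N k < N k.+1)%N).

Lemma block_exists i : N 0%N = 0%N -> exists k, (N k <= i < N k.+1)%N.
Proof.
move=> N0; elim: i => [|i [k /andP[Nki iNk]]].
  by exists 0%N; rewrite N0 /= -{1}N0.
have [iNk1|] := ltnP i.+1 (N k.+1).
  by exists k; rewrite iNk1 leqW.
move=> Nk1i; exists k.+1; rewrite Nk1i /=.
exact: leq_ltn_trans iNk (N_lt _).
Qed.

Lemma block_homo : {homo N : k l / (k <= l)%N}.
Proof. by apply: homo_leq => // [m n p|k]; [exact: leq_trans|exact: ltnW]. Qed.

Lemma leq_block k : (k <= N k)%N.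
Proof. by elim: k => // k IH; exact: leq_ltn_trans IH (N_lt k). Qed.

Lemma block_unique i k l :
  (N k <= i < N k.+1)%N -> (N l <= i < N l.+1)%N -> k = l.
Proof.
move=> /andP[ki ik] /andP[li il]; apply/eqP; rewrite eqn_leq.
by apply/andP; split; rewrite leqNgt; apply/negP => /block_homo; lia.
Qed.

End Blocks.

(** * Conditions that force small subset sums *)

Section UniformlySmallSubsums.
Context {R : realType} {X : normedModType R}.
Implicit Types (u : nat -> X) (A : pred nat).

Definition small_subsums u : Prop :=
  forall d : R, 0 < d -> exists N, forall n A,
    (forall i, A i -> (N <= i)%N) -> `|\sum_(0 <= i < n | A i) u i| < d.

(** Failure of the condition gives, past every index, a window with a large subset sum. Iterating
    the end of the window produces adjacent blocks, and the sets chosen in them are glued into one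
    [A]. *)
Lemma large_blocks u : ~ small_subsums u ->
  exists (d : R) (N : nat -> nat) (A : pred nat),
  [/\ 0 < d, N 0%N = 0%N, forall k, (N k < N k.+1)%N &
    forall k, d <= `|\sum_(N k <= i < N k.+1 | A i) u i|].
Proof.
move=> nsmall; have [d [d0 large]] : exists d : R, 0 < d /\ forall N,
    exists p : nat * pred nat, [/\ (N < p.1)%N &
      d <= `|\sum_(N <= i < p.1 | p.2 i) u i|].
  apply: contrapT => /forallNP H; apply: nsmall => d d0.
  apply: contrapT => /forallNP H'; apply: (H d); split=> // M.
  have := H' M => /existsNP[n] /existsNP[A] /not_implyP[AM /negP].
  rewrite -leNgt => dle; exists (n, A) => /=.
  have sumE : \sum_(0 <= i < n | A i) u i = \sum_(M <= i < n | A i) u i.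
    rewrite (big_nat_widenl M 0) //; apply: eq_bigl => i.
    by have [/AM ->|] := boolP (A i).
  rewrite sumE in dle; split=> //; rewrite ltnNge; apply/negP => nM.
  (* An empty window has sum [0 < d], so windows are nonempty and [N] increases strictly. *)
  by rewrite big_geq// normr0 leNgt d0 in dle.
have [f fP] := choice large.
pose N k := iter k (fun m => (f m).1) 0%N.
have N_lt k : (N k < N k.+1)%N by rewrite /N iterS; have [] := fP (N k).
have [b bP] := choice (fun i => block_exists N_lt i erefl).
exists d, N, (fun i => (f (N (b i))).2 i); split=> // k.
have [_] := fP (N k).
rewrite big_nat_cond [in X in _ -> X]big_nat_cond.
suff -> : \sum_(N k <= i < (f (N k)).1 | (N k <= i < (f (N k)).1)%N &&
    (f (N k)).2 i) u i = \sum_(N k <= i < N k.+1 |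
    (N k <= i < N k.+1)%N && (f (N (b i))).2 i) u i by [].
apply: eq_bigl => i; rewrite -[(f (N k)).1]/(N k.+1).
have [ik|//] := boolP (N k <= i < N k.+1)%N.
by rewrite (block_unique N_lt _ _ _ (bP i) ik).
Qed.

Lemma small_subsums_subseries u :
  (forall A, cvgn (series (fun i => if A i then u i else 0))) ->
  small_subsums u.
Proof.
move=> cu; apply: contrapT => /large_blocks[d [N [A [d0 N0 N_lt large]]]].
have /cvg_cauchy/cauchy_seriesP/(_ _ d0) := cu A.
move=> [[P Q] /= [[n _ nP] [m _ mQ]] PQ].
(* Since [k <= N k], this block lies beyond both Cauchy thresholds. *)
set k := maxn n m.
have kN := leq_block N_lt k; have NN := ltnW (N_lt k).
have /PQ : (P `*` Q) (N k, N k.+1).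
  by split; [apply: nP|apply: mQ] => /=; lia.
by rewrite /= -big_mkcond ltNge large.
Qed.

(* The divergent rearrangement lists, inside each block, the indices of [A] first. *)
Lemma small_subsums_rearrangement u :
  unconditionally_convergent u -> small_subsums u.
Proof.
move=> cu; apply: contrapT => /large_blocks[d [N [A [d0 N0 N_lt large]]]].
have [b bP] := choice (fun i => block_exists N_lt i N0).
have b_eq i k : (N k <= i < N k.+1)%N -> b i = k.
  exact: block_unique N_lt _ _ _ (bP i).
pose blk k := index_iota (N k) (N k.+1).
pose l k := [seq i <- blk k | A i] ++ [seq i <- blk k | predC A i].
have lP k : perm_eq (l k) (blk k) by rewrite perm_filterC.
have l_size k : size (l k) = (N k.+1 - N k)%N.
  by rewrite (perm_size (lP k)) size_iota.
have l_mem k i : (i \in l k) = (N k <= i < N k.+1)%N.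
  by rewrite (perm_mem (lP k)) mem_index_iota.
have l_uniq k : uniq (l k) by rewrite (perm_uniq (lP k)) iota_uniq.
(* [s] permutes each block according to the list [l]; [t] is its inverse. *)
pose s i := nth 0%N (l (b i)) (i - N (b i)).
pose t j := (N (b j) + index j (l (b j)))%N.
have sP i : (N (b i) <= s i < N (b i).+1)%N.
  by rewrite -l_mem mem_nth// l_size; have := bP i; lia.
have tP j : (N (b j) <= t j < N (b j).+1)%N.
  have := bP j; rewrite -l_mem -index_mem l_size /t; lia.
have s_bij : bijective s.
  exists t => i.
    rewrite /t (b_eq _ _ (sP i)) /s index_uniq //; last first.
      by rewrite l_size; have := bP i; lia.
    by have := bP i; lia.
  rewrite /s (b_eq _ _ (tP i)) /t addKn nth_index // l_mem; exact: bP.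
have /cvg_cauchy/cauchy_seriesP/(_ _ d0) := cu s s_bij.
move=> [[P Q] /= [[n _ nP] [m _ mQ]] PQ].
(* The first [c] positions of block [k] carry exactly its indices in [A]. *)
set k := maxn n m; pose c := size [seq i <- blk k | A i].
have cle : (c <= N k.+1 - N k)%N by rewrite -l_size size_cat leq_addr.
have kN := leq_block N_lt k.
have /PQ : (P `*` Q) (N k, (N k + c)%N).
  by split; [apply: nP|apply: mQ] => /=; lia.
rewrite /= ltNge.
suff -> : \sum_(N k <= i < N k + c) u (s i) =
    \sum_(N k <= i < N k.+1 | A i) u i.
  by rewrite large.
rewrite -[RHS]big_filter (big_nth 0%N) -/(blk k) -/c.
rewrite -{1}[N k]add0n big_addn addKn.
apply: eq_big_nat => i /andP[_ ic]; rewrite /s (b_eq _ k); last by lia.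
by rewrite addnK nth_cat -/c ic.
Qed.

Lemma small_subsums_compact {u} {K : set X} : compact K ->
  (forall n A, K (\sum_(0 <= i < n | A i) u i)) -> small_subsums u.
Proof.
move=> Kc Ku; apply: contrapT => /large_blocks[d [N [A [d0 N0 N_lt large]]]].
pose v k := \sum_(N k <= i < N k.+1 | A i) u i.
have Kv k : K (v k) by rewrite /v (big_nat_widenl _ 0)//.
have [w [Kw clw]] : exists w, (K `&` cluster (v @ \oo)) w.
  by apply: Kc; exists 0%N => // k _; exact: Kv.
(* With error [d / 4] per block, [m] blocks have a sum of norm at least
   [m * (3/4 * d) - m * (d/4) = m * d / 2]. *)
have close k : exists2 j, (k <= j)%N & `|w - v j| < d / 4.
  have d4 : 0 < d / 4 by rewrite divr_gt0.
  have [|y [[j /= kj <-] wy]] := clw [set v j | j in [set j | (k <= j)%N]]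
    (ball w (d / 4)) _ (nbhsx_ballx w _ d4).
    by exists k => // j kj; exists j.
  by exists j => //; move: wy; rewrite -ball_normE.
have w_large : 3 / 4 * d <= `|w|.
  have [j _ wj] := close 0%N; have dj : d <= `|v j| := large j.
  have := ler_normD (v j - w) w; rewrite subrK distrC; lra.
have sums m : exists k B,
    `|m%:R *: w - \sum_(0 <= i < N k | B i) u i| <= m%:R * (d / 4).
  elim: m => [|m [k [B kB]]].
    exists 0%N, pred0; rewrite N0 big_geq//.
    by rewrite scale0r subr0 normr0 mul0r.
  have [j kj wj] := close k.
  (* As [k <= j], the new block starts after the old set ends, so the union is disjoint and the
     total is again a subset sum. *)
  exists j.+1, (fun i => if (i < N k)%N then B i else (N j <= i)%N && A i).
  have NN := block_homo N_lt _ _ kj.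
  rewrite (@big_cat_nat _ _ _ (N k)) //=; last first.
    by have := N_lt j; lia.
  have -> : \sum_(0 <= i < N k | if (i < N k)%N then B i else
      (N j <= i)%N && A i) u i = \sum_(0 <= i < N k | B i) u i.
    rewrite big_nat_cond [RHS]big_nat_cond; apply: eq_bigl => i.
    by have [] := ltnP i (N k); rewrite /= ?andbF.
  have -> : \sum_(N k <= i < N j.+1 | if (i < N k)%N then B i else
      (N j <= i)%N && A i) u i = v j.
    rewrite /v (big_nat_widenl (N j) (N k))//.
    rewrite [LHS]big_nat_cond [RHS]big_nat_cond; apply: eq_bigl => i.
    by have [//|_] := ltnP i (N k); rewrite (andbC (A i)).
  rewrite -natr1 scalerDl scale1r mulrDl mul1r opprD addrACA.
  by rewrite (le_trans (ler_normD _ _))// lerD// ltW.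
have [M [_ KM]] := compact_bounded Kc.
have M1 : M < M + 1 by rewrite ltrDl.
have {}KM := KM _ M1.
(* Chosen so that [m * d / 2] exceeds the bound [M + 1] on [K]. *)
pose m := Num.bound (2 * (M + 1) / d).
have [k [B kB]] := sums m.
have := KM _ (Ku (N k) B) => /= SM.
have mM : 2 * (M + 1) < m%:R * d.
  rewrite -ltr_pdivrMr//; exact: unstable.ltr_bound.
have := ler_normD (m%:R *: w - \sum_(0 <= i < N k | B i) u i)
  (\sum_(0 <= i < N k | B i) u i).
rewrite subrK normrZ normr_nat => mw.
have := ler_wpM2l (ler0n R m) w_large; lra.
Qed.
End UniformlySmallSubsums.

(** * Consequences of small subset sums in a complete space *)

Section SmallSubsumsConsequences.
Context {R : realType} {X : completeNormedModType R}.
Implicit Types (u : nat -> X) (t : nat -> R).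

Lemma small_subsums_unconditional u :
  small_subsums u -> unconditionally_convergent u.
Proof.
move=> small s [t st ts]; apply/cauchy_cvgP/cauchy_seriesP => d d0.
have [N uN] := small d d0.
(* Every index below [N] is placed before position [M], so later positions carry only indices
   [>= N]. *)
pose M := \max_(j < N) (t j).+1.
exists ([set n | (M <= n)%N], [set n | (M <= n)%N]) => /=.
  by split; exists M.
move=> [m n] /= [Mm _].
pose B := \max_(i < n) (s i).+1.
pose A j := (m <= t j < n)%N.
have -> : \sum_(m <= i < n) u (s i) = \sum_(0 <= j < B | A j) u j.
  rewrite -(big_map s xpredT) -[RHS]big_filter; apply: perm_big.
  apply: uniq_perm; rewrite ?filter_uniq ?map_inj_uniq ?iota_uniq//.
    exact: can_inj st.
  move=> j; rewrite mem_filter mem_index_iota; apply/mapP/andP.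
    move=> [i]; rewrite mem_index_iota /A => imn ->; rewrite st imn; split=> //.
    have /andP[_ ilt] := imn.
    exact: (leq_bigmax (F := fun i : 'I_n => (s i).+1) (Ordinal ilt)).
  by move=> [Aj _]; exists (t j); rewrite ?ts// mem_index_iota.
apply: uN => j /andP[mj _]; rewrite leqNgt; apply/negP => jN.
have := leq_bigmax (F := fun j : 'I_N => (t j).+1) (Ordinal jN).
by rewrite -/M /=; lia.
Qed.

(* [t |-> v + \sum_i t i *: u i] is affine on the cube, so its norm is maximal at a vertex. *)
Lemma ler_norm_sign_sum (C : R) n u (v : X) :
  (forall c : pred nat,
    `|v + \sum_(0 <= i < n) (-1) ^+ c i *: u i| <= C) ->
  forall t, (forall i, `|t i| <= 1) ->
    `|v + \sum_(0 <= i < n) t i *: u i| <= C.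
Proof.
elim: n v => [|n IH] v vC t t1.
  by have := vC xpred0; rewrite !big_geq.
(* The last term is absorbed into the offset [v], over which the induction ranges. *)
rewrite big_nat_recr //= (addrC (\sum_(_ <= _ < _) _)) addrA.
apply: IH (t1) => c.
set S := \sum_(0 <= i < n) _.
have vertex (b : bool) : `|v + S + (-1) ^+ b *: u n| <= C.
  have := vC (fun i => if (i < n)%N then c i else b).
  rewrite big_nat_recr //= ltnn addrA.
  by congr (`|v + _ + _| <= C); apply: eq_big_nat => i /andP[_ ->].
have := t1 n; rewrite ler_norml => /andP[tn tn'].
have -> : v + t n *: u n + S =
    ((1 + t n) / 2) *: (v + S + (-1) ^+ false *: u n) +
    ((1 - t n) / 2) *: (v + S + (-1) ^+ true *: u n).
  rewrite addrAC; set w := v + S.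
  rewrite !(scalerDr _ w) addrACA !scalerA -(scalerDl w) -(scalerDl (u n)).
  rewrite expr0 expr1 -[LHS](congr1 (+%R^~ _) (scale1r w)).
  by congr (_ *: _ + _ *: _); field.
apply: le_trans (ler_normD _ _) _; rewrite !normrZ !ger0_norm; [|lra..].
have := vertex true; have := vertex false; nra.
Qed.

(** By convexity it suffices to treat signs, where the sum is a difference of two subset sums, each
    below [d / 2]. *)
Lemma small_subsums_coef {u} : small_subsums u -> forall d : R, 0 < d ->
  exists N, forall n t, (forall i, `|t i| <= 1) ->
    (forall i, (i < N)%N -> t i = 0) ->
    `|\sum_(0 <= i < n) t i *: u i| <= d.
Proof.
move=> small d d0; have [|N uN] := small (d / 2); first by rewrite divr_gt0.
exists N => n t t1 t0.
(* Sign vectors have no zero entries, so the vanishing below [N] is moved from [t] to the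
   vectors. *)
pose w i := if (i < N)%N then 0 else u i.
have -> : \sum_(0 <= i < n) t i *: u i = 0 + \sum_(0 <= i < n) t i *: w i.
  rewrite add0r; apply: eq_bigr => i _; rewrite /w.
  by case: ifP => // /t0 ->; rewrite scaler0 scale0r.
apply: ler_norm_sign_sum t1 => c; rewrite add0r.
have -> : \sum_(0 <= i < n) (-1) ^+ c i *: w i =
    \sum_(0 <= i < n | ~~ c i && (N <= i)%N) u i -
    \sum_(0 <= i < n | c i && (N <= i)%N) u i.
  rewrite [X in _ = X - _]big_mkcond [X in _ = _ - X]big_mkcond -sumrB.
  apply: eq_bigr => i _; rewrite /w ltnNge; case: (c i); case: (N <= i)%N => /=;
  by rewrite ?scaler0 ?subr0 ?sub0r ?expr0 ?expr1 ?scale1r ?scaleN1r ?oppr0.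
apply: le_trans (ler_normB _ _) _.
have tail (B : pred nat) : `|\sum_(0 <= i < n | B i && (N <= i)%N) u i| < d / 2.
  by apply: uN => i /andP[].
have := tail c; have := tail (predC c); rewrite /=; lra.
Qed.

Lemma small_subsums_cvg {u t} : small_subsums u -> (forall i, `|t i| <= 1) ->
  cvgn (series (fun i => t i *: u i)).
Proof.
move=> small t1; apply/cauchy_cvgP/cauchy_seriesP => d d0.
have d2 : 0 < d / 2 by rewrite divr_gt0.
have [N uN] := small_subsums_coef small _ d2.
exists ([set n | (N <= n)%N], [set n | (N <= n)%N]) => /=.
  by split; exists N.
move=> [m n] /= [Nm _].
have -> : \sum_(m <= i < n) t i *: u i =
    \sum_(0 <= i < n) (if (m <= i)%N then t i else 0) *: u i.
  rewrite (big_nat_widenl _ 0)// big_mkcond; apply: eq_bigr => i _ /=.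
  by case: ifP; rewrite ?scale0r.
have := uN n (fun i => if (m <= i)%N then t i else 0).
move=> /(_ _ _)/le_lt_trans; apply; last by rewrite ltr_pdivrMr//; lra.
  by move=> i; case: ifP; rewrite ?normr0.
by move=> i iN; case: ifP => //; lia.
Qed.

(** [N] is independent of [t]: partial sums converge uniformly on the cube. *)
Lemma small_subsums_approx {u} : small_subsums u -> forall d : R, 0 < d ->
  exists N, forall t, (forall i, `|t i| <= 1) ->
  `|limn (series (fun i => t i *: u i)) - \sum_(0 <= i < N) t i *: u i| <= d.
Proof.
move=> small d d0; have [N uN] := small_subsums_coef small _ d0.
exists N => t t1; set x := \sum_(0 <= i < N) _.
have tu := small_subsums_cvg small t1.
have cx : (fun n => `|series (fun i => t i *: u i) n - x|) @ \oo -->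
    `|limn (series (fun i => t i *: u i)) - x|.
  by apply: cvg_norm; apply: cvgB => //; exact: cvg_cst.
rewrite -(cvg_lim _ cx)//; apply: limr_le.
  by apply/cvg_ex; eexists; exact: cx.
exists N => // n /= Nn.
rewrite /series /= (big_cat_nat (leq0n _) Nn)//= -/x addrAC subrr add0r.
have -> : \sum_(N <= i < n) t i *: u i =
    \sum_(0 <= i < n) (if (N <= i)%N then t i else 0) *: u i.
  rewrite (big_nat_widenl _ 0)// big_mkcond; apply: eq_bigr => i _ /=.
  by case: ifP; rewrite ?scale0r.
apply: uN => i; first by case: ifP; rewrite ?normr0.
by move=> iN; rewrite leqNgt iN.
Qed.

Lemma small_subsums_compact_cube u : small_subsums u ->
  compact [set limn (series (fun i => t i *: u i)) |
           t in [set t : nat -> R | forall i, `|t i| <= 1]].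
Proof.
move=> small.
have compact1 : compact [set x : R | `|x| <= 1].
  have <- : [set` `[-1, 1]] = [set x : R | `|x| <= 1].
    by apply/seteqP; split=> x; rewrite /= in_itv /= ler_norml.
  exact: segment_compact.
have := @tychonoff nat (fun=> R) _ (fun=> compact1).
apply: continuous_compact; apply/subspace_continuousP => t tP.
apply/cvgrPdist_lt => d d0.
have d4 : 0 < d / 4 by rewrite divr_gt0.
have [N uN] := small_subsums_approx small _ d4.
(* [f] involves finitely many coordinates, hence is continuous for the product topology; the limit
   differs from it by at most [d / 4] at both [t] and [t']. *)
pose f (t' : prod_topology (fun _ : nat => R)) :=
  \sum_(0 <= i < N) t' i *: u i.
have fc : f t' @[t' --> nbhs (t : prod_topology _)] --> f t.
  apply: cvg_big; first exact: add_continuous.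
  move=> i _; apply: cvgZr_tmp.
  exact: (@proj_continuous nat (fun=> R) i t).
have /cvgrPdist_lt/(_ _ d4) := fc.
rewrite near_withinE; apply: filterS => t' ft' t'P.
have := uN _ tP; have := uN _ t'P.
rewrite /from_subspace -/(f t) -/(f t').
set a := limn _ => at'; set b := limn _ => bt.
have -> : b - a = b - f t + (f t - f t') - (a - f t').
  by rewrite addrA subrK opprB addrA subrK.
have := ler_normD (b - f t) (f t - f t').
have := ler_normB (b - f t + (f t - f t')) (a - f t'); lra.
Qed.

End SmallSubsumsConsequences.

(** * Bricks of a Schauder basis *)

Section Bricks.
Context {R : realType} {X : completeNormedModType R}.
Context {e : nat -> X} {es : nat -> X -> R} {eps : nat -> R}.
Context (basis_e : schauder_basis e) (coord_es : coordinate_functionals e es).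
Context (eps_ge0 : forall n, 0 <= eps n).

Lemma coordinate_functionalsP {x : X} {a : nat -> R} :
  series (fun n => a n *: e n) @ \oo --> x -> forall n, es n x = a n.
Proof.
move=> ax n; have [b [_ b_unique]] := basis_e x.
by rewrite -(b_unique _ ax) (b_unique (es^~ x) (coord_es x)).
Qed.

(* Where [eps n = 0] the quotient [a n / eps n] is [0], and so is [a n]. *)
Lemma brick_coefE {a : nat -> R} : (forall n, `|a n| <= eps n) ->
  (forall n, `|a n / eps n| <= 1) /\
  (fun n => (a n / eps n) *: (eps n *: e n)) = (fun n => a n *: e n).
Proof.
move=> a_eps; split=> [n|].
  rewrite normrM normfV (ger0_norm (eps_ge0 n)).
  have [->|eps0] := eqVneq (eps n) 0; first by rewrite invr0 mulr0.
  by rewrite ler_pdivrMr ?mul1r// lt0r eps0 eps_ge0.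
apply/funext => n; rewrite scalerA.
have [eps0|eps0] := eqVneq (eps n) 0; last by rewrite divfK.
by have := a_eps n; rewrite eps0 normr_le0 => /eqP->; rewrite mulr0.
Qed.

Lemma brick_small_subsums : compact (brick es eps) ->
  small_subsums (fun n => eps n *: e n).
Proof.
move=> /small_subsums_compact; apply=> n A k.
(* The subset sum is an eventually constant series with coefficients [a], so its coordinates can be
   read off and it lies in the brick. *)
pose a i := if (i < n)%N && A i then eps i else 0.
rewrite (@coordinate_functionalsP _ a) /a.
  by case: ifP => _; rewrite ?normr0 ?eps_ge0// ger0_norm.
apply: cvg_near_cst; exists n => // m /= nm.
rewrite /series /= (big_cat_nat (leq0n _) nm)/=.
rewrite [X in _ + X]big_nat_cond [X in _ + X]big1 ?addr0.
  rewrite [RHS]big_mkcond; apply: eq_big_nat => i /andP[_ ->] /=.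
  by case: ifP; rewrite ?scale0r.
by move=> i /andP[/andP[ni _] _]; rewrite ltnNge ni scale0r.
Qed.

Lemma small_subsums_brick : small_subsums (fun n => eps n *: e n) ->
  compact (brick es eps).
Proof.
move=> small; suff <- : [set limn (series (fun i => t i *: (eps i *: e i))) |
    t in [set t : nat -> R | forall i, `|t i| <= 1]] = brick es eps.
  exact: small_subsums_compact_cube.
apply/seteqP; split=> [_ [t /= t1 <-] n|x xK].
  have := small_subsums_cvg small t1.
  under eq_fun do rewrite scalerA.
  move=> /coordinate_functionalsP ->.
  by rewrite normrM (ger0_norm (eps_ge0 n)) ler_piMl.
have [t1 tE] := brick_coefE xK.
by exists (fun n => es n x / eps n) => //; rewrite tE; exact/cvg_lim.
Qed.

Lemma small_subsums_holistic : small_subsums (fun n => eps n *: e n) ->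
  holistic e eps.
Proof.
move=> small a /brick_coefE[t1 <-]; exact: small_subsums_cvg.
Qed.

Lemma holistic_small_subsums : holistic e eps ->
  small_subsums (fun n => eps n *: e n).
Proof.
move=> hol; apply: small_subsums_subseries => A.
have -> : (fun i => if A i then eps i *: e i else 0) =
    (fun i => (if A i then eps i else 0) *: e i).
  by apply/funext => i; case: ifP; rewrite ?scale0r.
by apply: hol => n; case: ifP => _; rewrite ?normr0 ?eps_ge0// ger0_norm.
Qed.

(** Every sign series is within [1] of its first [N] terms, whose norm is bounded independently of
    the signs. *)
Lemma small_subsums_r_unc : small_subsums (fun n => eps n *: e n) ->
  (r_unc e eps < +oo)%E.
Proof.
move=> small; have [N NP] := small_subsums_approx small 1 ltr01.
apply: (@le_lt_trans _ _
  (1 + \sum_(0 <= i < N) `|eps i *: e i|)%:E); last exact: ltry.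
apply: ge_ereal_sup => _ [theta theta1 <-].
have t1 i : `|theta i| <= 1.
  by have [->|->] := theta1 i; rewrite ?normrN normr1.
rewrite /series_norm; under eq_fun do rewrite -scalerA.
rewrite asboolT; last exact: small_subsums_cvg.
rewrite lee_fin -[X in `|X|](subrK (\sum_(0 <= i < N) theta i *: (eps i *: e i))).
apply: le_trans (ler_normD _ _) _; rewrite lerD ?NP//.
apply: le_trans (ler_norm_sum _ _ _) _; apply: ler_sum => i _.
by rewrite normrZ ler_piMl.
Qed.

(* The subseries over [A] is half the sum of the two sign series for [1] and [2 * 1_A - 1]. *)
Lemma r_unc_small_subsums : (r_unc e eps < +oo)%E ->
  small_subsums (fun n => eps n *: e n).
Proof.
move=> r_fin.
have sgn_cvg theta : (forall n, theta n = 1 \/ theta n = -1) ->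
    cvgn (series (fun n => (theta n * eps n) *: e n)).
  move=> theta1; apply: contrapT => ndiv.
  (* A divergent sign series contributes [+oo] to the supremum. *)
  suff : (+oo <= r_unc e eps)%E by rewrite leNgt r_fin.
  apply: ereal_sup_ubound; exists theta => //.
  by rewrite /series_norm asboolF.
apply: small_subsums_subseries => A.
have c1 := sgn_cvg (fun=> 1) (fun=> or_introl erefl).
pose theta n : R := if A n then 1 else -1.
have cA : cvgn (series (fun n => (theta n * eps n) *: e n)).
  by apply: sgn_cvg => n; rewrite /theta; case: ifP; [left|right].
suff -> : series (fun i => if A i then eps i *: e i else 0) =
    2^-1 *: (series (fun n => (1 * eps n) *: e n) +
             series (fun n => (theta n * eps n) *: e n)).
  exact: is_cvgZl_tmp (is_cvgD c1 cA).
apply/funext => n; rewrite /series /=.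
rewrite -[RHS]/(2^-1 *: (_ + _)) -big_split /= scaler_sumr.
apply: eq_bigr => i _; rewrite /theta; case: ifP => _.
  by rewrite !mul1r -scalerDl scalerA; congr (_ *: _); field.
by rewrite mul1r mulN1r scaleNr subrr scaler0.
Qed.

End Bricks.

Theorem theorem3p7 (R : realType) (X : completeNormedModType R)
  (e : nat -> X) (es : nat -> X -> R) (eps : nat -> R)
  (hB : schauder_basis e) (hN : normalized e)
  (hes : coordinate_functionals e es)
  (heps : forall n, 0 <= eps n) :
  [<-> compact (brick es eps);
       holistic e eps;
       unconditionally_convergent (fun n => eps n *: e n);
       (r_unc e eps < +oo)%E].
Proof.
(* Each implication of the cycle passes through [small_subsums]. *)
split=> [/(brick_small_subsums hB hes heps)|].
  exact: small_subsums_holistic.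
split=> [/(holistic_small_subsums heps)|].
  exact: small_subsums_unconditional.
split=> [/small_subsums_rearrangement|/r_unc_small_subsums].
  exact: small_subsums_r_unc.
exact: small_subsums_brick.
Qed.
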